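(* For every positive integer $b$, $R_2(x-y=bz)=b^2+3b+1$.
   Context: For a positive integer $N$ let $[N]=\{1,\dots,N\}$. For a linear homogeneous equation $\mathcal{E}$ with integer coefficients and a positive integer $c$, the Rado number $R_c(\mathcal{E})$ is the least positive integer $N$ such that every $c$-coloring of $[N]$ contains a monochromatic solution to $\mathcal{E}$, i.e. a solution whose variables all take values in $[N]$ (not necessarily distinct) having the same color. If no such $N$ exists, $R_c(\mathcal{E})=\infty$. *)

(* Defs.v *)
From HB Require Import structures.
From mathcomp Require Import all_boot all_order all_algebra.
From mathcomp Require Import boolp.

Set Implicit Arguments.
Unset Strict Implicit.
Unset Printing Implicit Defensive.

Import Order.TTheory GRing.Theory Num.Theory.
Local Open Scope ring_scope.

(* The linear homogeneous equation a_0 x_0 + ... + a_(k-1) x_(k-1) = 0 is given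
   by its tuple of coefficients. *)
Definition lin_equation (k : nat) := k.-tuple int.

(* The ordinal i : 'I_N stands for the element i + 1 of [N] = {1, ..., N}. *)
Definition pos_val (N : nat) (i : 'I_N) : nat := i.+1.

Definition is_solution (k : nat) (E : lin_equation k) (N : nat)
    (x : {ffun 'I_k -> 'I_N}) : bool :=
  \sum_(i < k) tnth E i * (pos_val (x i))%:Z == 0.

Definition monochromatic (c k N : nat) (chi : {ffun 'I_N -> 'I_c})
    (x : {ffun 'I_k -> 'I_N}) : bool :=
  [exists q : 'I_c, forall i : 'I_k, chi (x i) == q].

Definition rado_property (c k : nat) (E : lin_equation k) (N : nat) : bool :=
  (0 < N)%N &&
  [forall chi : {ffun 'I_N -> 'I_c},
    [exists x : {ffun 'I_k -> 'I_N}, is_solution E x && monochromatic chi x]].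

(* None stands for an infinite Rado number. *)
Definition rado_number (c k : nat) (E : lin_equation k) : option nat :=
  match pselect (exists N : nat, rado_property c E N) with
  | left ex => Some (ex_minn ex)
  | right _ => None
  end.

(* x - y = b z, with the unknowns in the order x, y, z. *)
Definition diff_equation (b : nat) : lin_equation 3 :=
  [tuple 1; -1; - b%:Z].

(* Main.v *)
Require Import Defs.
From mathcomp Require Import all_boot all_order all_algebra.
From mathcomp Require Import boolp zify.

(** Upper bound: if 1 is red and there is no monochromatic solution of
    x = y + b z, then b + 1 is blue, (b + 1)^2 is red and b^2 + 3b + 1 =
    (b + 1)^2 + b is blue; since b^2 + 3b + 1 = (b + 1) + b (b + 2), the number
    b + 2 is red, but then (b + 1)^2 = 1 + b (b + 2) is a red solution.
    Lower bound: colour the interval from b + 1 to b^2 + 2b blue and everything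
    else up to b^2 + 3b red. *)

Set Implicit Arguments.
Unset Strict Implicit.
Unset Printing Implicit Defensive.

Lemma is_solution_diff_equation (b N : nat) (x : {ffun 'I_3 -> 'I_N}) :
  is_solution (diff_equation b) x =
  (pos_val (x ord0) ==
   pos_val (x (lift ord0 ord0)) + b * pos_val (x (lift ord0 (lift ord0 ord0)))).
Proof.
rewrite /is_solution !big_ord_recl big_ord0 /=.
rewrite !(tnth_nth 0%R) /=.
apply/eqP/eqP; lia.
Qed.

(** Needed to read equality of two colours back from boolean colourings. *)
Lemma I2_eq0 (p q : 'I_2) : (p == ord0) = (q == ord0) -> p = q.
Proof. by case: p q => [[|[|]]] // ? [[|[|]]] // ? _; apply: val_inj. Qed.

(** Eliminating x as [y + b * z] leaves a single bound, and colouring all of [nat] by [bool]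
    replaces ordinals by plain arithmetic. *)
Lemma rado_property_diff_equationP (b N : nat) :
  0 < b -> 0 < N ->
  reflect (forall f : nat -> bool, exists y z,
             [/\ 0 < y, 0 < z, y + b * z <= N, f (y + b * z) = f y & f z = f y])
          (rado_property 2 (diff_equation b) N).
Proof.
case: N => // N b_gt0 _; apply: (iffP forallP) => [rado f | sol chi].
- have /existsP[x] := rado [ffun i : 'I_N.+1 => inord (f i.+1)].
  rewrite is_solution_diff_equation => /andP[/eqP sol_x /existsP[q /forallP col]].
  have {col}fE i : f (pos_val (x i)) = q :> nat.
    by have /eqP<- := col i; rewrite ffunE inordK //; case: (f _).
  have fE2 i j : f (pos_val (x i)) = f (pos_val (x j)).
    by have := fE i; rewrite -(fE j); do 2 case: (f _).
  exists (pos_val (x (lift ord0 ord0))).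
  exists (pos_val (x (lift ord0 (lift ord0 ord0)))).
  by rewrite -sol_x; split=> //; exact: ltn_ord.
(* The shift [n.-1] undoes [pos_val]; values of [inord] outside [N] are arbitrary but never reached,
   since [0 < b] bounds z as well as y. *)
- have [y [z [y_gt0 z_gt0 leN fxy fzy]]] :=
    sol (fun n => chi (inord n.-1) == ord0).
  have [zN yN] : z <= N.+1 /\ y <= N.+1 by nia.
  have posK n : 0 < n -> n <= N.+1 -> pos_val (inord n.-1 : 'I_N.+1) = n.
    by case: n => // n _ ?; rewrite /pos_val inordK.
  apply/existsP.
  exists [ffun i : 'I_3 => inord (nth 0 [:: y + b * z; y; z] i).-1].
  apply/andP; split.
    by rewrite is_solution_diff_equation !ffunE /= !posK //; lia.
  apply/existsP; exists (chi (inord y.-1)); apply/forallP=> i; apply/eqP.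
  rewrite ffunE; apply: I2_eq0.
  by case: i => [[|[|[|]]]].
Qed.

Lemma rado_property_upper (b : nat) :
  0 < b -> rado_property 2 (diff_equation b) (b ^ 2 + 3 * b + 1).
Proof.
move=> b_gt0; apply/rado_property_diff_equationP => // [|f]; first by lia.
have [fx1|/eqP fx1] := eqVneq (f (b + 1)) (f 1).
  by exists 1, 1; split=> //; [nia | rewrite -fx1; congr f; lia].
have [fx2|/eqP fx2] := eqVneq (f (b ^ 2 + 2 * b + 1)) (f (b + 1)).
  by exists (b + 1), (b + 1); split=> //; try nia; rewrite -fx2; congr f; nia.
have [fx3|/eqP fx3] := eqVneq (f (b ^ 2 + 3 * b + 1)) (f 1).
  exists (b ^ 2 + 2 * b + 1), 1; split; try nia.
  have -> : b ^ 2 + 2 * b + 1 + b * 1 = b ^ 2 + 3 * b + 1 by nia.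
  (* With two colours, (b + 1)^2 and 1 agree because both differ from b + 1. *)
  lia.
have [fx4|/eqP fx4] := eqVneq (f (b + 2)) (f 1).
  exists 1, (b + 2); split; try nia.
  have -> : 1 + b * (b + 2) = b ^ 2 + 2 * b + 1 by nia.
  lia.
exists (b + 1), (b + 2); split; try nia.
have -> : b + 1 + b * (b + 2) = b ^ 2 + 3 * b + 1 by nia.
lia.
Qed.

Lemma rado_property_lower (b N : nat) :
  0 < b -> rado_property 2 (diff_equation b) N -> b ^ 2 + 3 * b < N.
Proof.
move=> b_gt0 rado; have N_gt0 : 0 < N by case/andP: rado.
move/rado_property_diff_equationP: rado => /(_ b_gt0 N_gt0).
move=> /(_ (fun n => b < n <= b ^ 2 + 2 * b)) [y [z [y_gt0 z_gt0 leN]]].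
move=> fxy fzy; rewrite ltnNge; apply/negP => leNb.
(* Blue y, z give y + b z >= (b + 1)^2, beyond the blue interval. Red y, z <= b give a sum from b +
   1 to b^2 + b, which is blue. If one of the red y, z exceeds b^2 + 2b, the sum exceeds b^2 +
   3b. *)
have [yb|yb] := leqP y b; have [zb|zb] := leqP z b; nia.
Qed.

Theorem theorem3p1 (b : nat) (hb : (0 < b)%N) :
  rado_number 2 (diff_equation b) = Some (b ^ 2 + 3 * b + 1)%N.
Proof.
have upper := rado_property_upper hb.
rewrite /rado_number; case: pselect => [ex|[]]; last by exists (b ^ 2 + 3 * b + 1).
case: ex_minnP => m rado_m min_m; congr Some; apply/eqP.
by rewrite eqn_leq min_m // addn1 rado_property_lower.
Qed.
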